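(* Consider the multiscale P-IMPES scheme described in the context, with initial saturations satisfying $S_w^{H,0}+S_n^{H,0}=1$. For every time level $n\ge 0$ the following hold. (i) (Local mass conservation for both phases.) If $S_w^{H,n+1}\in Q_h$ is computed from the wetting-phase update $$\left(\phi\frac{S_w^{H,n+1}-S_w^{H,n}}{t_{n+1}-t_n},q\right)+\beta_w(\mathbf u_t^{H,n+1},q;S_w^{H,n})=(F_w,q)+\beta_c(\xi_c^{H,n+1},q;S_w^{H,n})\qquad\forall q\in Q_h,$$ and $S_n^{H,n+1}:=1-S_w^{H,n+1}$, then the non-wetting phase also satisfies the conservative equation $$\left(\phi\frac{S_n^{H,n+1}-S_n^{H,n}}{t_{n+1}-t_n},q\right)+\beta_n(\mathbf u_t^{H,n+1},q;S_w^{H,n})=(F_n,q)-\beta_c(\xi_c^{H,n+1},q;S_w^{H,n})\qquad\forall q\in Q_h .$$ Conversely, if $S_w^{H,n+1},S_n^{H,n+1}\in Q_h$ are computed from these two equations at every time level, then $S_w^{H,n+1}+S_n^{H,n+1}=1$ for all $n$. (ii) (Unbiased property.) The same discrete saturations $S_w^{H,n+1},S_n^{H,n+1}$ and phase velocities $$\mathbf u_w^{H,n+1}=f_w(S_w^{H,n})\mathbf u_t^{H,n+1}-f_w(S_w^{H,n})f_n(S_w^{H,n})\xi_c^{H,n+1},\qquad \mathbf u_n^{H,n+1}=f_n(S_w^{H,n})\mathbf u_t^{H,n+1}+f_w(S_w^{H,n})f_n(S_w^{H,n})\xi_c^{H,n+1}$$ are obtained whether one solves the first (wetting-phase) equation and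 sets $S_n^{H,n+1}=1-S_w^{H,n+1}$, or solves the second (non-wetting-phase) equation and sets $S_w^{H,n+1}=1-S_n^{H,n+1}$.
   Context: $\Omega\subset\mathbb R^2$ is partitioned by a fine mesh $\mathcal T_h$ with cells $K^h$. $V_h$ is the lowest-order Raviart--Thomas space ($RT_0$) on $\mathcal T_h$, $Q_h$ is the space of piecewise constants on $\mathcal T_h$, and $(\cdot,\cdot)$ is the $L^2(\Omega)$ inner product. $\phi>0$ is the constant porosity; $\lambda_\alpha=k_{r\alpha}/\mu_\alpha$ ($\alpha=w,n$, wetting and non-wetting) are the phase mobilities, functions of $S_w$; $\lambda_t=\lambda_w+\lambda_n$; $f_\alpha=\lambda_\alpha/\lambda_t$, so $f_w+f_n=1$. $F_\alpha$ are source/sink terms and $F_t=F_w+F_n$. $t_0<t_1<\dots$ are the time levels. The saturations $S_w^{H,n},S_n^{H,n}$ lie in $Q_h$. Numerical fluxes: for $\mathbf v\in V_h$, $q\in Q_h$, $$\beta_\alpha(\mathbf v,q;S_w)=\sum_{K^h\in\mathcal T_h}\int_{\partial K^h}f_\alpha(S^{*}_{w,\alpha})\,\mathbf v\cdot\mathbf n\,q,\qquad \beta_c(\mathbf v,q;S_w)=\sum_{K^h\in\mathcal T_h}\int_{\partial K^h}f_n(S^{*}_{w,n})f_w(S^{*}_{w,w})\,\mathbf v\cdot\mathbf n\,q,$$ where $\mathbf n$ is the outward normal of $K^h$ and, on an edge $e$ between $K^h$ and a neighbour $K^{h,1}$, $S_\alpha^*|_e=S_\alpha|_{K^h}$ if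 the phase flux $\{\mathbf u_\alpha\cdot\mathbf n\}_e\ge0$ and $S_\alpha^*|_e=S_\alpha|_{K^{h,1}}$ otherwise; $S^*_{w,w}=S^*_w$ and $S^*_{w,n}=1-S^*_n$; on inflow boundary edges $S^*_{w,\alpha}|_e=S_w|_{K^h}$. At the initial time, with the given initial saturation $S_w^0$, these terms are replaced by $\beta_\alpha(\mathbf v,q;S_w^0)=\sum_{K^h}\int_{K^h}f_\alpha(S_w^0)\,q\,\nabla\cdot\mathbf v$ and $\beta_c(\mathbf v,q;S_w^0)=\sum_{K^h}\int_{K^h}f_w(S_w^0)f_n(S_w^0)\,q\,\nabla\cdot\mathbf v$. In all cases $\beta_\alpha,\beta_c$ are bilinear in $(\mathbf v,q)$ once the saturation and the upwind directions are fixed. At each time level the scheme determines, uniquely from $S_w^{H,n}$, a capillary velocity $\xi_c^{H,n+1}\in V_h$ and a (postprocessed multiscale) total velocity $\mathbf u_t^{H,n+1}\in V_h$, and the latter satisfies fine-grid conservation of total mass: $$\beta_w(\mathbf u_t^{H,n+1},q;S_w^{H,n})+\beta_n(\mathbf u_t^{H,n+1},q;S_w^{H,n})=(F_t,q)\qquad\forall q\in Q_h.$$ *)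

(* Defs.v *)
From mathcomp Require Import all_boot all_order all_algebra.
From mathcomp Require Import all_classical all_reals all_analysis.

Set Implicit Arguments.
Unset Strict Implicit.
Unset Printing Implicit Defensive.

Import Order.TTheory GRing.Theory Num.Theory.
Import numFieldNormedType.Exports.

Local Open Scope classical_set_scope.
Local Open Scope ring_scope.

Section Plane.
Variable R : realType.
Implicit Types (a b x v w : R * R) (e : (R * R) * (R * R)).

Definition area2 :
    {measure set (measurableTypeR R * measurableTypeR R)%type -> \bar R} :=
  (@lebesgue_measure R \x @lebesgue_measure R)%E.

Definition dot v w : R := v.1 * w.1 + v.2 * w.2.
Definition det2 v w : R := v.1 * w.2 - v.2 * w.1.
(* The library norm on R * R is the max norm. *)
Definition enorm v : R := Num.sqrt (dot v v).

Definition comb a (s : R) v (t : R) w : R * R :=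
  (a.1 + s * v.1 + t * w.1, a.2 + s * v.2 + t * w.2).

Definition segment e : set (R * R) :=
  [set comb e.1 s (e.2 - e.1) 0 0 | s in `[0, 1]].

(* Integral over the segment [e] with respect to arc length. *)
Definition edge_integral e (g : R * R -> R) : R :=
  enorm (e.2 - e.1) *
  \int[@lebesgue_measure R]_(s in `[0, 1]) g (comb e.1 s (e.2 - e.1) 0 0).

Definition divergence (v : R * R -> R * R) x : R :=
  derive1 (fun s => (v (s, x.2)).1) x.1 + derive1 (fun s => (v (x.1, s)).2) x.2.

Definition L2inner (D : set (R * R)) (f g : R * R -> R) : R :=
  \int[area2]_(x in D) (f x * g x).

Definition L2 (D : set (R * R)) (f : R * R -> R) : Prop :=
  measurable_fun D f /\ area2.-integrable D (fun x => (f x ^+ 2)%:E).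

(* A cell is the image of a reference element under the affine map
   (s, t) |-> corner + s dir1 + t dir2.  The reference element is the unit
   triangle when [is_tri] holds and the unit square otherwise, so that triangles
   and parallelograms (in particular rectangles) are covered. *)
Record cell := Cell {
  is_tri : bool;
  corner : R * R;
  dir1 : R * R;
  dir2 : R * R }.

Implicit Types c : cell.

Definition cell_point c (s t : R) : R * R := comb (corner c) s (dir1 c) t (dir2 c).

Definition closed_cell c : set (R * R) :=
  [set x | exists s t : R, x = cell_point c s t /\
     if is_tri c then [/\ 0 <= s, 0 <= t & s + t <= 1]
     else 0 <= s <= 1 /\ 0 <= t <= 1].

Definition open_cell c : set (R * R) :=
  [set x | exists s t : R, x = cell_point c s t /\
     if is_tri c then [/\ 0 < s, 0 < t & s + t < 1]
     else 0 < s < 1 /\ 0 < t < 1].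

Definition orientation c : R := det2 (dir1 c) (dir2 c).

(* Listed along the boundary; counterclockwise iff [orientation c] > 0. *)
Definition vertices c : seq (R * R) :=
  if is_tri c then [:: cell_point c 0 0; cell_point c 1 0; cell_point c 0 1]
  else [:: cell_point c 0 0; cell_point c 1 0; cell_point c 1 1;
           cell_point c 0 1].

Definition edges c : seq ((R * R) * (R * R)) :=
  zip (vertices c) (rot 1 (vertices c)).

Definition is_edge c e : bool :=
  (e \in edges c) || ((e.2, e.1) \in edges c).

(* Outward unit normal of [c] on the edge [e], for [e \in edges c]. *)
Definition normal c e : R * R :=
  let d := e.2 - e.1 in
  let k := Num.sg (orientation c) / enorm d in
  (k * d.2, - (k * d.1)).

(* Local lowest-order Raviart-Thomas space, contravariant Piola image of the
   reference one: (a1 + b s, a2 + b t) on the triangle, which gives the usual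
   fields x |-> a + b x, and (a1 + b1 s, a2 + b2 t) on the square. *)
Definition RT0_local c (v : R * R -> R * R) : Prop :=
  exists (a : R * R) (b1 b2 : R),
    (is_tri c -> b1 = b2) /\
    forall s t : R, v (cell_point c s t) = comb a (b1 * s) (dir1 c) (b2 * t) (dir2 c).

End Plane.

Section Discretization.
Variables (R : realType) (T : finType).

(* A velocity field that is smooth inside each cell has, on an interior edge, one
   trace from each side; it is therefore a family of fields indexed by cells. *)
Definition field := T -> R * R -> R * R.

(* Elements of Q_h, given by their cell values. *)
Definition Qh := {ffun T -> R}.

(* [None] stands for the initial time; [Some (uw, un)] carries the phase
   velocities that determine the upwind directions. *)
Definition upwinding := option (field * field).

Record problem := Problem {
  Omega : set (R * R);
  mesh : T -> cell R;
  phi : R;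
  krw : R -> R;
  krn : R -> R;
  muw : R;
  mun : R;
  Fw : R * R -> R;
  Fn : R * R -> R;
  time : nat -> R;
  Sw0 : R * R -> R;
  (* The capillary and total velocities of level n.+1, as functions of
     S_w^{H,n} and of the upwind directions in force at level n. *)
  xi_of : nat -> Qh -> upwinding -> field;
  ut_of : nat -> Qh -> upwinding -> field }.

Variable P : problem.
Implicit Types (K L : T) (e : (R * R) * (R * R)) (v : field) (q : Qh).

Definition lambda_w (s : R) : R := krw P s / muw P.
Definition lambda_n (s : R) : R := krn P s / mun P.
Definition lambda_t (s : R) : R := lambda_w s + lambda_n s.
Definition fw (s : R) : R := lambda_w s / lambda_t s.
Definition fn (s : R) : R := lambda_n s / lambda_t s.
Definition Ft (x : R * R) : R := Fw P x + Fn P x.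

(* Two distinct closed cells are disjoint or share exactly one vertex or exactly
   one edge. *)
Definition conforming : Prop := forall K L, K != L ->
  let I := closed_cell (mesh P K) `&` closed_cell (mesh P L) in
  [\/ I = set0,
      exists a, [/\ a \in vertices (mesh P K), a \in vertices (mesh P L) &
                    I = [set a]] |
      exists e, [/\ e \in edges (mesh P K), is_edge (mesh P L) e &
                    I = segment e] ].

(* [Omega] may or may not contain the points of the edges. *)
Record is_mesh : Prop := IsMesh {
  mesh_nondegenerate : forall K, orientation (mesh P K) != 0;
  mesh_disjoint : forall K L, K != L ->
    open_cell (mesh P K) `&` open_cell (mesh P L) = set0;
  mesh_conforming : conforming;
  mesh_inner : \bigcup_K open_cell (mesh P K) `<=` Omega P;
  mesh_cover : Omega P `<=` \bigcup_K closed_cell (mesh P K) }.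

Record admissible : Prop := Admissible {
  Omega_measurable : measurable (Omega P);
  admissible_mesh : is_mesh;
  phi_gt0 : 0 < phi P;
  muw_gt0 : 0 < muw P;
  mun_gt0 : 0 < mun P;
  lambda_t_neq0 : forall s, 0 <= s <= 1 -> lambda_t s != 0;
  Fw_L2 : L2 (Omega P) (Fw P);
  Fn_L2 : L2 (Omega P) (Fn P);
  time_lt : forall n, time P n < time P n.+1 }.

(* The cell on the other side of the edge [e] of [K]; [None] on the boundary. *)
Definition neighbour K e : option T :=
  [pick L | (L != K) && is_edge (mesh P L) e].

(* The space V_h: local RT0 fields with continuous normal components. *)
Definition Vh v : Prop :=
  (forall K, RT0_local (mesh P K) (v K)) /\
  forall K L e, e \in edges (mesh P K) -> neighbour K e = Some L ->
    forall x, segment e x ->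
      dot (v K x) (normal (mesh P K) e) = dot (v L x) (normal (mesh P K) e).

(* The function on the plane with the given cell values; open cells are used so
   that values do not add up on edges, which are negligible. *)
Definition piecewise q (x : R * R) : R :=
  \sum_K q K * \1_(open_cell (mesh P K)) x.

Definition inner (f g : R * R -> R) : R := L2inner (Omega P) f g.

(* {u . n} at a point x of the edge [e] of [K], with n outward to [K]. *)
Definition avg_flux (u : field) K e (x : R * R) : R :=
  let n := normal (mesh P K) e in
  match neighbour K e with
  | Some L => (dot (u K x) n + dot (u L x) n) / 2
  | None => dot (u K x) n
  end.

Definition Sstar_ww (Sw : Qh) (uw : field) K e x : R :=
  match neighbour K e with
  | Some L => if 0 <= avg_flux uw K e x then Sw K else Sw L
  | None => Sw K
  end.

(* On a boundary edge: 1 - S_n on the outflow part, S_w on the inflow part. *)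
Definition Sstar_wn (Sw Sn : Qh) (un : field) K e x : R :=
  match neighbour K e with
  | Some L => 1 - (if 0 <= avg_flux un K e x then Sn K else Sn L)
  | None => if 0 <= avg_flux un K e x then 1 - Sn K else Sw K
  end.

Definition edge_form (coef : T -> (R * R) * (R * R) -> R * R -> R) v q : R :=
  \sum_K \sum_(e <- edges (mesh P K))
    edge_integral e
      (fun x => coef K e x * dot (v K x) (normal (mesh P K) e) * q K).

Definition initial_form (coef : R * R -> R) v q : R :=
  \sum_K \int[area2 R]_(x in closed_cell (mesh P K))
    (coef x * q K * divergence (v K) x).

Definition beta_w (Sw Sn : Qh) (d : upwinding) v q : R :=
  match d with
  | None => initial_form (fun x => fw (Sw0 P x)) v q
  | Some (uw, un) => edge_form (fun K e x => fw (Sstar_ww Sw uw K e x)) v q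
  end.

Definition beta_n (Sw Sn : Qh) (d : upwinding) v q : R :=
  match d with
  | None => initial_form (fun x => fn (Sw0 P x)) v q
  | Some (uw, un) => edge_form (fun K e x => fn (Sstar_wn Sw Sn un K e x)) v q
  end.

Definition beta_c (Sw Sn : Qh) (d : upwinding) v q : R :=
  match d with
  | None => initial_form (fun x => fw (Sw0 P x) * fn (Sw0 P x)) v q
  | Some (uw, un) =>
      edge_form (fun K e x => fn (Sstar_wn Sw Sn un K e x) *
                              fw (Sstar_ww Sw uw K e x)) v q
  end.

(* The discrete unknowns at all time levels; the values of the velocities at
   level 0 are irrelevant. *)
Record run := Run {
  Sw : nat -> Qh;
  Sn : nat -> Qh;
  xi : nat -> field;
  ut : nat -> field;
  uw : nat -> field;
  un : nat -> field }.

Implicit Type X : run.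

Definition directions X (n : nat) : upwinding :=
  if n is 0%N then None else Some (uw X n, un X n).

Definition bw X n := beta_w (Sw X n) (Sn X n) (directions X n).
Definition bn X n := beta_n (Sw X n) (Sn X n) (directions X n).
Definition bc X n := beta_c (Sw X n) (Sn X n) (directions X n).

Definition total_mass_conservation X n : Prop := forall q,
  bw X n (ut X n.+1) q + bn X n (ut X n.+1) q = inner Ft (piecewise q).

(* The velocities of level n.+1 are those produced by the scheme from level n. *)
Record velocity_step X n : Prop := VelocityStep {
  xi_def : xi X n.+1 = xi_of P n (Sw X n) (directions X n);
  ut_def : ut X n.+1 = ut_of P n (Sw X n) (directions X n);
  xi_Vh : Vh (xi X n.+1);
  ut_Vh : Vh (ut X n.+1);
  ut_conservation : total_mass_conservation X n;
  uw_def : uw X n.+1 = (fun K x =>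
    let s := Sw X n K in
    fw s *: ut X n.+1 K x - (fw s * fn s) *: xi X n.+1 K x);
  un_def : un X n.+1 = (fun K x =>
    let s := Sw X n K in
    fn s *: ut X n.+1 K x + (fw s * fn s) *: xi X n.+1 K x) }.

Definition storage (S : nat -> Qh) n (x : R * R) : R :=
  phi P * ((piecewise (S n.+1) x - piecewise (S n) x) /
           (time P n.+1 - time P n)).

Definition wetting_equation X n : Prop := forall q,
  inner (storage (Sw X) n) (piecewise q) + bw X n (ut X n.+1) q =
  inner (Fw P) (piecewise q) + bc X n (xi X n.+1) q.

Definition nonwetting_equation X n : Prop := forall q,
  inner (storage (Sn X) n) (piecewise q) + bn X n (ut X n.+1) q =
  inner (Fn P) (piecewise q) - bc X n (xi X n.+1) q.

Definition saturations_sum_to_1 X n : Prop := forall K, Sw X n K + Sn X n K = 1.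

(* Level n.+1 obtained from the wetting equation and S_n := 1 - S_w. *)
Definition wetting_step X n : Prop :=
  [/\ velocity_step X n, wetting_equation X n &
      forall K, Sn X n.+1 K = 1 - Sw X n.+1 K].

(* Level n.+1 obtained from the non-wetting equation and S_w := 1 - S_n. *)
Definition nonwetting_step X n : Prop :=
  [/\ velocity_step X n, nonwetting_equation X n &
      forall K, Sw X n.+1 K = 1 - Sn X n.+1 K].

(* Level n.+1 obtained from both equations. *)
Definition two_phase_step X n : Prop :=
  [/\ velocity_step X n, wetting_equation X n & nonwetting_equation X n].

End Discretization.

(* Main.v *)
Require Import Defs.
From mathcomp Require Import all_boot all_order all_algebra.
From mathcomp Require Import all_classical all_reals all_analysis.
From mathcomp Require Import measurable_realfun ring lra.
Import Order.TTheory GRing.Theory Num.Theory.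

Local Open Scope classical_set_scope.
Local Open Scope ring_scope.

(** Summing the two phase equations eliminates both the capillary term, which
    occurs with opposite signs, and, by conservation of total mass, the fluxes
    together with the sources.  What remains says that the storage terms of
    the two phases cancel against every test function.  Hence, as soon as the
    saturations sum to 1 at one level, the non-wetting equation is equivalent,
    given the wetting one, to the saturations summing to 1 at the next level
    ([nonwetting_equationP]).  One direction is local conservation of the
    non-wetting phase, the other is the converse claim.

    For the unbiased property, a run driven by the wetting equation therefore
    satisfies the non-wetting equation as well.  If it agrees at one level with
    a run driven by the non-wetting equation, both have the same velocities and
    fluxes, and the non-wetting saturation at the next level is the solution of
    one and the same explicit equation ([nonwetting_equation_inj]); the
    agreement propagates by induction on the level ([unbiased_step]).

    Neither argument looks inside the flux forms.  The analytic facts needed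
    are that testing piecewise constants against piecewise constants separates
    the cells, which rests on every open cell having positive and finite area
    ([area2_open_cell], [inner_piecewise]), and that the source term is
    additive in the source, which rests on the products of square-integrable
    functions being integrable ([integrable_mul_L2]). *)

(** * Areas of mesh cells *)

Section Cells.
Context {R : realType}.
Implicit Types (c : cell R) (x p : R * R).

Notation plane := (measurableTypeR R * measurableTypeR R)%type.

Definition open_square p (r : R) : set plane :=
  `]p.1 - r, p.1 + r[ `*` `]p.2 - r, p.2 + r[.

Lemma measurable_open_square p r : measurable (open_square p r).
Proof. by apply: measurableX; exact: measurable_itv. Qed.

Lemma area2_open_square p r : 0 < r ->
  area2 R (open_square p r) = ((r + r) ^+ 2)%:E.
Proof.
move=> r0; rewrite [LHS]product_measure1E; [|exact: measurable_itv..].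
have len y : lebesgue_measure `]y - r, y + r[ = (r + r)%:E.
  rewrite lebesgue_measure_itv /= lte_fin ifT; last by lra.
  by rewrite -EFinB; congr EFin; ring.
by rewrite expr2 EFinM; congr (_ * _)%E; exact: len.
Qed.

Lemma measurable_half_plane (a b k : R) :
  measurable ([set x | 0 < a * x.1 + b * x.2 + k] : set plane).
Proof.
have mf : measurable_fun [set: plane] (fun x => a * x.1 + b * x.2 + k).
  apply: measurable_funD; last exact: measurable_cst.
  apply: measurable_funD; apply: measurable_funM;
    by [exact: measurable_cst|exact: measurable_fst|exact: measurable_snd].
have := mf measurableT `]0, +oo[%classic (measurable_itv _).
rewrite setTI; congr (measurable _).
by apply/seteqP; split => x /=; rewrite in_itv /= andbT.
Qed.

(** Cramer's rule for the coordinates (s, t) in [cell_point c s t = x]. *)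
Definition local_s c x : R := det2 (x - corner c) (dir2 c) / orientation c.
Definition local_t c x : R := det2 (dir1 c) (x - corner c) / orientation c.

Lemma cell_pointP c x (s t : R) : orientation c != 0 ->
  x = cell_point c s t <-> s = local_s c x /\ t = local_t c x.
Proof.
case: c x => b [k1 k2] [d1 d2] [e1 e2] [x1 x2].
rewrite /local_s /local_t /orientation /cell_point /comb /det2 /= => D0.
split=> [[-> ->]|[-> ->]]; first by split; field.
by congr pair; field.
Qed.

Lemma open_cellE c x : orientation c != 0 ->
  open_cell c x <->
  if is_tri c
  then [/\ 0 < local_s c x, 0 < local_t c x & local_s c x + local_t c x < 1]
  else 0 < local_s c x < 1 /\ 0 < local_t c x < 1.
Proof.
move=> D0; split=> [[s [t [/(cell_pointP _ _ _ _ D0)[-> ->]]]] //|cx].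
exists (local_s c x), (local_t c x); split => //.
by apply/cell_pointP.
Qed.

(** In local coordinates a cell is a finite intersection of half-planes. *)
Lemma measurable_open_cell c : orientation c != 0 ->
  measurable (open_cell c : set plane).
Proof.
move=> D0; set D := orientation c in D0 *.
pose H u v w : set plane := [set x | 0 < u + v * local_s c x + w * local_t c x].
have mH u v w : measurable (H u v w).
  have := measurable_half_plane
    ((v * (dir2 c).2 - w * (dir1 c).2) / D) ((w * (dir1 c).1 - v * (dir2 c).1) / D)
    (u + (v * ((corner c).2 * (dir2 c).1 - (corner c).1 * (dir2 c).2)
        + w * ((corner c).1 * (dir1 c).2 - (corner c).2 * (dir1 c).1)) / D).
  congr (measurable _); apply: eq_set => x; congr (is_true (_ < _)).
  rewrite /local_s /local_t /det2 /= -/D; field.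
  exact: D0.
have -> : open_cell c = H 0 1 0 `&` H 0 0 1 `&`
    (if is_tri c then H 1 (-1) (-1) else H 1 (-1) 0 `&` H 1 0 (-1)).
  apply/seteqP; split=> x.
    move=> /(open_cellE _ _ D0); case: ifP => _.
      by move=> [s0 t0 st]; split; [split|]; rewrite /H /=; lra.
    by move=> [/andP[s0 s1] /andP[t0 t1]]; split; split; rewrite /H /=; lra.
  move=> H1; apply/(open_cellE _ _ D0); move: H1; case: ifP => _.
    by move=> [[]]; rewrite /H /= => s0 t0 st; split; lra.
  move=> [[]]; rewrite /H /= => s0 t0 [s1 t1]; split; lra.
by case: ifP => _; repeat apply: measurableI; exact: mH.
Qed.

(** Both reference elements lie in the unit square, so in each coordinate a
    point of the cell differs from the corner by at most the sum of the absolute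
    values of the components of the two directions. *)
Lemma open_cell_sub_square c : exists2 r : R, 0 < r &
  open_cell c `<=` open_square (corner c) r.
Proof.
case: c => b [k1 k2] [d1 d2] [e1 e2].
exists (1 + `|d1| + `|e1| + `|d2| + `|e2|).
  by rewrite -!addrA ltr_wpDr// !addr_ge0.
move=> x [s [t [-> st]]].
have {st} [s01 t01] : 0 < s < 1 /\ 0 < t < 1.
  by case: ifP st => _ // [? ? ?]; split; lra.
have bnd (u y : R) : 0 < u < 1 -> - `|y| <= u * y <= `|y|.
  move=> u01; rewrite -ler_norml normrM gtr0_norm; last by lra.
  by rewrite ler_piMl//; lra.
have := (bnd s d1 s01, bnd t e1 t01, bnd s d2 s01, bnd t e2 t01).
have := (normr_ge0 d1, normr_ge0 e1, normr_ge0 d2, normr_ge0 e2).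
move=> [[[h1 h2] h3] h4] [[[]]] + + + +.
by do 4 move=> /andP[? ?]; split; rewrite /= in_itv /=; apply/andP; split; lra.
Qed.

(** Both reference elements contain the open square of radius 1/4 about the
    point (1/4, 1/4). *)
Lemma square_sub_open_cell c : orientation c != 0 ->
  exists p, exists2 r : R, 0 < r & open_square p r `<=` open_cell c.
Proof.
move=> D0; set M := 1 + `|(dir1 c).1| + `|(dir1 c).2| + `|(dir2 c).1| + `|(dir2 c).2|.
have M0 : 0 < M by rewrite /M -!addrA ltr_wpDr// !addr_ge0.
have aD : 0 < `|orientation c| by rewrite normr_gt0.
have [p Ep] : exists p, p = cell_point c 4^-1 4^-1 by exists (cell_point c 4^-1 4^-1).
exists p, (`|orientation c| / (4 * M)).
  by rewrite divr_gt0// mulr_gt0.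
set r := _ / _; move=> x [] /=; rewrite !in_itv /= => h1 h2.
have rM : r * M = `|orientation c| / 4 by rewrite /r; field; lra.
(* The radius is chosen so that local coordinates, which are affine with
   slopes bounded by M / |orientation c|, vary by less than 1/4. *)
have small (y1 y2 a b : R) : - r < y1 < r -> - r < y2 < r ->
    `|a| + `|b| < M -> `|(y1 * a + y2 * b) / orientation c| < 4^-1.
  move=> y1r y2r abM; rewrite normrM normfV ltr_pdivrMr// [4^-1 * _]mulrC -rM.
  apply: (le_lt_trans (ler_normD _ _)); rewrite !normrM.
  have r0 : 0 < r by rewrite divr_gt0// mulr_gt0.
  apply: (@le_lt_trans _ _ (r * (`|a| + `|b|))); last by rewrite ltr_pM2l.
  by rewrite mulrDr lerD// ler_wpM2r// ler_norml; lra.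
pose y1 := x.1 - p.1.
pose y2 := x.2 - p.2.
have hy1 : - r < y1 < r by rewrite /y1; lra.
have hy2 : - r < y2 < r by rewrite /y2; lra.
have Es : local_s c x = 4^-1 + (y1 * (dir2 c).2 + y2 * - (dir2 c).1) / orientation c.
  rewrite /local_s /y1 /y2 Ep /cell_point /comb; move: D0; rewrite /orientation /det2 /= => D0.
  by field.
have Et : local_t c x = 4^-1 + (y1 * - (dir1 c).2 + y2 * (dir1 c).1) / orientation c.
  rewrite /local_t /y1 /y2 Ep /cell_point /comb; move: D0; rewrite /orientation /det2 /= => D0.
  by field.
have := (normr_ge0 (dir1 c).1, normr_ge0 (dir1 c).2, normr_ge0 (dir2 c).1, normr_ge0 (dir2 c).2).
move=> [[[n1 n2] n3] n4].
have : `|local_s c x - 4^-1| < 4^-1.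
  by rewrite Es addrC addKr small// normrN /M; lra.
have : `|local_t c x - 4^-1| < 4^-1.
  by rewrite Et addrC addKr small// normrN /M; lra.
rewrite !ltr_norml => tb sb.
by apply/(open_cellE _ _ D0); case: ifP => _; split; lra.
Qed.

(** The cell lies between two open squares, whose areas are known. *)
Lemma area2_open_cell c : orientation c != 0 ->
  (0 < area2 R (open_cell c) < +oo)%E.
Proof.
move=> D0; have mc := measurable_open_cell _ D0; apply/andP; split.
  have [p [r r0 sub]] := square_sub_open_cell _ D0.
  apply: (@lt_le_trans _ _ (area2 R (open_square p r))).
    by rewrite area2_open_square// lte_fin exprn_gt0// addr_gt0.
  by apply: le_measure; rewrite ?inE//; exact: measurable_open_square.
have [r r0 sub] := open_cell_sub_square c.
apply: (@le_lt_trans _ _ (area2 R (open_square (corner c) r))).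
  by apply: le_measure; rewrite ?inE//; exact: measurable_open_square.
by rewrite area2_open_square// ltry.
Qed.

End Cells.

(** * Square-integrable functions *)

Section SquareIntegrable.
Context {R : realType} (D : set (measurableTypeR R * measurableTypeR R))
  (mD : measurable D).
Implicit Types f g : R * R -> R.

(** The bound is |f g| <= f^2 + g^2. *)
Lemma integrable_mul_L2 f g : L2 D f -> L2 D g ->
  (area2 R).-integrable D (EFin \o (fun x => f x * g x)).
Proof.
move=> [mf if2] [mg ig2].
apply: (le_integrable mD _ _ (integrableD mD if2 ig2)).
  by apply/measurable_EFinP; exact: measurable_funM mf mg.
move=> x _; rewrite -[leRHS]/(`|f x ^+ 2 + g x ^+ 2|)%:E lee_fin.
rewrite [leRHS]ger0_norm ?addr_ge0 ?sqr_ge0// ler_norml.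
by apply/andP; split; nra.
Qed.

Lemma L2innerDl f1 f2 g : L2 D f1 -> L2 D f2 -> L2 D g ->
  L2inner D (fun x => f1 x + f2 x) g = L2inner D f1 g + L2inner D f2 g.
Proof.
move=> Lf1 Lf2 Lg; rewrite /L2inner -(RintegralD mD).
- by apply: eq_Rintegral => x _; rewrite mulrDl.
- exact: integrable_mul_L2.
- exact: integrable_mul_L2.
Qed.

End SquareIntegrable.

(** * Piecewise constant functions *)

Section Mesh.
Context {R : realType} {T : finType} (P : problem R T)
  (hP : admissible P).
Implicit Types (q a b : Qh R T) (K : T).

Let D0 K : orientation (mesh P K) != 0 := mesh_nondegenerate (admissible_mesh hP) K.
Let mO : measurable (Omega P : set (measurableTypeR R * measurableTypeR R)) :=
  Omega_measurable hP.

Definition cell_area K : R := fine (area2 R (open_cell (mesh P K))).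

Lemma cell_area_gt0 K : 0 < cell_area K.
Proof. by apply: fine_gt0; exact: area2_open_cell. Qed.

(** The mixed terms vanish because distinct open cells are disjoint. *)
Lemma piecewise_mul a b x :
  piecewise P a x * piecewise P b x = piecewise P [ffun K => a K * b K] x.
Proof.
rewrite /piecewise big_distrl /=; apply: eq_bigr => K _; rewrite ffunE.
rewrite big_distrr /= (bigD1 K)//= big1 ?addr0; last first.
  move=> L LK; rewrite mulrACA -[X in _ * X]/((\1_(_ : set _) \* \1_(_ : set _)) x) -indicI.
  by rewrite (mesh_disjoint (admissible_mesh hP)) 1?eq_sym// indic0 mulr0.
by rewrite mulrACA; congr (_ * _); rewrite indicE; case: (_ \in _); rewrite ?mulr1 ?mulr0.
Qed.

Lemma integral_cell_cst (k : R) K :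
  (area2 R).-integrable (Omega P) (EFin \o (fun x => k * \1_(open_cell (mesh P K)) x)) /\
  \int[area2 R]_(x in Omega P) (k * \1_(open_cell (mesh P K)) x) = k * cell_area K.
Proof.
have mC := measurable_open_cell _ (D0 K).
have cO : open_cell (mesh P K) `<=` Omega P.
  by move=> x Kx; apply: (mesh_inner (admissible_mesh hP)); exists K.
have E : (\int[area2 R]_(x in Omega P) (\1_(open_cell (mesh P K)) x)%:E =
    area2 R (open_cell (mesh P K)))%E.
  by rewrite integral_indic// (setIidl cO).
have i1 : (area2 R).-integrable (Omega P) (EFin \o \1_(open_cell (mesh P K))).
  apply/integrableP; split.
    by apply/measurable_EFinP; exact: measurable_indic.
  have /andP[_] := area2_open_cell _ (D0 K); rewrite -E; congr (_ < _)%E.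
  by apply: eq_integral => x _ /=; rewrite ger0_norm.
split.
  have := integrableZl mO k i1; apply: eq_integrable => // x _.
by rewrite RintegralZl// /Rintegral E.
Qed.

Lemma integral_piecewise q :
  (area2 R).-integrable (Omega P) (EFin \o piecewise P q) /\
  \int[area2 R]_(x in Omega P) piecewise P q x = \sum_K q K * cell_area K.
Proof.
pose h K x := (q K * \1_(open_cell (mesh P K)) x)%:E.
have ih K : (area2 R).-integrable (Omega P) (h K) by have [] := integral_cell_cst (q K) K.
have E x : (piecewise P q x)%:E = (\sum_K h K x)%E by rewrite sumEFin.
split.
  have := integrable_sum mO (index_enum T) (P := xpredT) (fun K _ => ih K).
  by apply: eq_integrable => // x _ /=; rewrite E.
transitivity (fine (\int[area2 R]_(x in Omega P) (\sum_K h K x))%E).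
  by congr fine; apply: eq_integral => x _; exact: E.
rewrite integral_sum// -sum_fine; last by move=> K _; exact: integrable_fin_num.
by apply: eq_bigr => K _; have [] := integral_cell_cst (q K) K.
Qed.

(** The square of a piecewise constant function is again one. *)
Lemma L2_piecewise q : L2 (Omega P) (piecewise P q).
Proof.
split.
  have [/integrableP[/measurable_EFinP mq _] _] := integral_piecewise q.
  exact: mq.
have [i _] := integral_piecewise [ffun K => q K * q K].
apply: eq_integrable i => // x _ /=.
by rewrite -piecewise_mul expr2.
Qed.

(** The cell indicators form an orthogonal basis of Q_h, with the cell areas
    as squared norms. *)
Lemma inner_piecewise a b :
  inner P (piecewise P a) (piecewise P b) = \sum_K a K * b K * cell_area K.
Proof.
rewrite /inner /L2inner; have [_] := integral_piecewise [ffun K => a K * b K].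
under eq_bigr do rewrite ffunE.
move=> <-; apply: eq_Rintegral => x _; exact: piecewise_mul.
Qed.

End Mesh.

(** * The two phase equations *)

Section Scheme.
Context {R : realType} {T : finType} (P : problem R T)
  (hP : admissible P).
Implicit Types (X Y : run R T) (S : nat -> Qh R T) (q : Qh R T) (n : nat).

Lemma inner_storage S n q : inner P (storage P S n) (piecewise P q) =
  phi P / (time P n.+1 - time P n) *
    \sum_K (S n.+1 K - S n K) * q K * cell_area P K.
Proof.
have -> : storage P S n = piecewise P
    [ffun K => phi P / (time P n.+1 - time P n) * (S n.+1 K - S n K)].
  apply/funext => x; rewrite /storage /piecewise -sumrB mulrA mulrAC mulr_sumr.
  by apply: eq_bigr => K _; rewrite ffunE -mulrBl mulrA.
rewrite inner_piecewise// mulr_sumr; apply: eq_bigr => K _.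
by rewrite ffunE !mulrA.
Qed.

Lemma storage_coef_neq0 n : phi P / (time P n.+1 - time P n) != 0.
Proof.
by rewrite gt_eqF// divr_gt0 ?subr_gt0; [|exact: phi_gt0|exact: time_lt].
Qed.

(** Testing with the indicator of one cell isolates its value, since its area
    is not zero. *)
Lemma cellwise_eq0 (a : T -> R) :
  (forall q, \sum_K a K * q K * cell_area P K = 0) -> forall K, a K = 0.
Proof.
move=> a0 K; have := a0 [ffun L => (L == K)%:R].
rewrite (bigD1 K)//= big1 ?addr0 => [|L /negPf LK]; last first.
  by rewrite ffunE LK mulr0 mul0r.
rewrite ffunE eqxx mulr1 => /eqP; rewrite mulf_eq0 => /orP[/eqP//|].
by rewrite gt_eqF ?cell_area_gt0.
Qed.

(** The two storage terms together are that of the sum of the saturations,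
    and the level-n sum is 1; the cancellation thus says that the increment of
    the sum has zero inner product with all of Q_h. *)
Lemma storage_cancelP X n : saturations_sum_to_1 X n ->
  (forall q, inner P (storage P (Sw X) n) (piecewise P q) +
             inner P (storage P (Sn X) n) (piecewise P q) = 0) <->
  saturations_sum_to_1 X n.+1.
Proof.
move=> sum1.
have E q : inner P (storage P (Sw X) n) (piecewise P q) +
    inner P (storage P (Sn X) n) (piecewise P q) =
    phi P / (time P n.+1 - time P n) *
    \sum_K (Sw X n.+1 K + Sn X n.+1 K - 1) * q K * cell_area P K.
  rewrite !inner_storage -mulrDr -big_split; congr (_ * _).
  by apply: eq_bigr => K _ /=; rewrite -(sum1 K); ring.
split=> [h K|h q].
  apply/eqP; rewrite -subr_eq0; apply/eqP.
  apply: (cellwise_eq0 (fun K => Sw X n.+1 K + Sn X n.+1 K - 1)) => q.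
  have /eqP := h q; rewrite E mulf_eq0 (negPf (storage_coef_neq0 n)).
  by move=> /eqP.
by rewrite E big1 ?mulr0// => K _; rewrite h subrr !mul0r.
Qed.

Lemma inner_Ft q : inner P (Ft P) (piecewise P q) =
  inner P (Fw P) (piecewise P q) + inner P (Fn P) (piecewise P q).
Proof.
apply: L2innerDl; [exact: Omega_measurable|exact: Fw_L2|exact: Fn_L2|].
exact: L2_piecewise.
Qed.

(** Adding the wetting equation to the non-wetting one and subtracting the
    total mass balance leaves exactly the cancellation of the storage terms. *)
Lemma nonwetting_equationP X n : saturations_sum_to_1 X n ->
  total_mass_conservation P X n -> wetting_equation P X n ->
  nonwetting_equation P X n <-> saturations_sum_to_1 X n.+1.
Proof.
move=> sum1 tot wet; rewrite -(storage_cancelP _ _ sum1).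
split=> h q; have := (tot q, wet q, h q); rewrite inner_Ft => -[[]]; lra.
Qed.

(** The fluxes are evaluated at level n, so the equation is explicit: with
    equal data at level n it prescribes the storage term, hence the value of
    S_n at level n.+1 in each cell. *)
Lemma nonwetting_equation_inj X Y n : Sw X n = Sw Y n -> Sn X n = Sn Y n ->
  directions X n = directions Y n -> xi X n.+1 = xi Y n.+1 ->
  ut X n.+1 = ut Y n.+1 -> nonwetting_equation P X n ->
  nonwetting_equation P Y n -> Sn X n.+1 = Sn Y n.+1.
Proof.
move=> eSw eSn ed exi eut nwX nwY; apply/ffunP => K; apply/eqP.
rewrite -subr_eq0; apply/eqP.
apply: (cellwise_eq0 (fun K => Sn X n.+1 K - Sn Y n.+1 K)) => q.
apply: (mulfI (storage_coef_neq0 n)); rewrite mulr0.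
have : inner P (storage P (Sn X) n) (piecewise P q) =
       inner P (storage P (Sn Y) n) (piecewise P q).
  have := nwX q; have := nwY q; rewrite /bn /bc eSw eSn ed exi eut; lra.
move=> /eqP; rewrite -subr_eq0 !inner_storage -mulrBr -sumrB => /eqP E.
rewrite -[RHS]E; congr (_ * _); apply: eq_bigr => L _.
by rewrite eSn; ring.
Qed.

Lemma wetting_step_nonwetting X n : saturations_sum_to_1 X n ->
  wetting_step P X n -> nonwetting_equation P X n.
Proof.
move=> sum1 [vX wet eSn]; apply/nonwetting_equationP => //.
  exact: ut_conservation vX.
by move=> K; rewrite eSn addrC subrK.
Qed.

(** Both runs satisfy the non-wetting equation with the same data: the first
    by local conservation, the second by construction. *)
Lemma unbiased_step X Y n : saturations_sum_to_1 X n ->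
  Sw X n = Sw Y n -> Sn X n = Sn Y n -> directions X n = directions Y n ->
  wetting_step P X n -> nonwetting_step P Y n ->
  [/\ Sw X n.+1 = Sw Y n.+1, Sn X n.+1 = Sn Y n.+1,
      uw X n.+1 = uw Y n.+1 & un X n.+1 = un Y n.+1].
Proof.
move=> sum1 eSw eSn ed stepX [vY nwY oneY].
have nwX := wetting_step_nonwetting X n sum1 stepX; case: stepX => vX _ oneX.
have exi : xi X n.+1 = xi Y n.+1 by rewrite (xi_def vX) (xi_def vY) eSw ed.
have eut : ut X n.+1 = ut Y n.+1 by rewrite (ut_def vX) (ut_def vY) eSw ed.
have eSn1 : Sn X n.+1 = Sn Y n.+1.
  exact: nonwetting_equation_inj eSw eSn ed exi eut nwX nwY.
split=> //.
- by apply/ffunP => K; rewrite oneY -eSn1 oneX opprB addrC subrK.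
- by rewrite (uw_def vX) (uw_def vY) eSw exi eut.
- by rewrite (un_def vX) (un_def vY) eSw exi eut.
Qed.

Lemma wetting_steps_sum1 X n : saturations_sum_to_1 X 0 ->
  (forall m, (m < n)%N -> wetting_step P X m) -> saturations_sum_to_1 X n.
Proof.
case: n => // n _ /(_ n (ltnSn n)) [_ _ eSn] K.
by rewrite eSn addrC subrK.
Qed.

End Scheme.

Theorem mainTheorem1 (R : realType) (T : finType) (P : problem R T)
    (hP : admissible P) :
  [/\
      (forall (X : run R T) (n : nat),
         saturations_sum_to_1 X 0 ->
         (forall m : nat, (m <= n)%N -> wetting_step P X m) ->
         nonwetting_equation P X n),
      (forall (X : run R T) (n : nat),
         saturations_sum_to_1 X 0 ->
         (forall m : nat, (m < n)%N -> two_phase_step P X m) ->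
         saturations_sum_to_1 X n) &
      (forall (X Y : run R T) (n : nat),
         saturations_sum_to_1 X 0 ->
         Sw X 0 = Sw Y 0 -> Sn X 0 = Sn Y 0 ->
         (forall m : nat, (m <= n)%N -> wetting_step P X m) ->
         (forall m : nat, (m <= n)%N -> nonwetting_step P Y m) ->
         [/\ Sw X n.+1 = Sw Y n.+1, Sn X n.+1 = Sn Y n.+1,
             uw X n.+1 = uw Y n.+1 & un X n.+1 = un Y n.+1])].
Proof.
split.
- move=> X n sum0 steps; apply: wetting_step_nonwetting (steps n _) => //.
  exact: (wetting_steps_sum1 P X n sum0 (fun m hm => steps m (ltnW hm))).
- move=> X; elim=> [//|n IHn] sum0 steps.
  have [vX wet nwet] := steps n (ltnSn n).
  apply/(nonwetting_equationP P hP X n) => //; last exact: ut_conservation vX.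
  exact: (IHn sum0 (fun m hm => steps m (ltnW hm))).
- move=> X Y n sum0 eSw0 eSn0; elim: n => [|n IHn] stepsX stepsY.
    by apply: unbiased_step (stepsX 0%N _) (stepsY 0%N _).
  have [] := IHn (fun m hm => stepsX m (leqW hm)) (fun m hm => stepsY m (leqW hm)).
  move=> eSw eSn euw eun.
  apply: unbiased_step (stepsX n.+1 _) (stepsY n.+1 _) => //.
    exact: (wetting_steps_sum1 P X n.+1 sum0 (fun m hm => stepsX m (ltnW hm))).
  by rewrite /directions euw eun.
Qed.
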